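(* For every graph $G$, $r(G)\le \left\lfloor \frac{\Delta(G)}{2}\right\rfloor r_v(G)$ and $r(G)\le \left\lfloor \frac{\Delta(G)}{2}\right\rfloor r'_v(G)$; that is, $\frac{r(G)}{r_v(G)}\le \left\lfloor \frac{\Delta(G)}{2}\right\rfloor$ and $\frac{r(G)}{r'_v(G)}\le \left\lfloor \frac{\Delta(G)}{2}\right\rfloor$. Furthermore, these bounds are best possible: for every integer $\Delta\ge 2$ there is a graph $G$ with $\Delta(G)=\Delta$ and $\frac{r(G)}{r_v(G)}=\frac{r(G)}{r'_v(G)}=\left\lfloor \frac{\Delta}{2}\right\rfloor$.
   Context: Graphs are finite, connected, may have multiple edges but no loops. The resistance $r(G)$ is the minimum number of edges that have to be removed from $G$ to obtain a $\Delta(G)$-edge-colorable subgraph. A graph $H$ is class 1 if $\chi'(H)=\Delta(H)$, where $\chi'$ is the chromatic index. $r_v(G)$ is the minimum number of vertices that have to be removed from $G$ to obtain a class 1 graph, and $r'_v(G)$ is the minimum number of vertices that have to be removed from $G$ to obtain a graph $K$ with $\chi'(K)\le \Delta(G)$. *)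

(* Defs.v *)
From mathcomp Require Import all_boot all_order all_algebra.

Set Implicit Arguments.
Unset Strict Implicit.
Unset Printing Implicit Defensive.

(* Edges form a type of their own, so parallel edges are allowed; two distinct
   ends exclude loops. Connectedness is a separate predicate because deleting
   edges or vertices need not preserve it. *)
Record mgraph := MGraph {
  vertex : finType;
  edge : finType;
  ends : edge -> {set vertex};
  card_ends : forall e, #|ends e| = 2
}.

Definition adjacent (G : mgraph) : rel (vertex G) :=
  fun x y => [exists e, ends e == [set x; y]].

Definition connected (G : mgraph) : Prop :=
  0 < #|vertex G| /\ forall x y : vertex G, connect (@adjacent G) x y.

Definition degree (G : mgraph) (x : vertex G) : nat :=
  #|[set e : edge G | x \in ends e]|.

Definition max_degree (G : mgraph) : nat := \max_(x : vertex G) degree x.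

Definition proper_coloring (G : mgraph) (k : nat) (c : {ffun edge G -> 'I_k}) :
    bool :=
  [forall e, forall f,
     (e != f) && ~~ [disjoint ends e & ends f] ==> (c e != c f)].

Definition edge_colorable (G : mgraph) (k : nat) : bool :=
  [exists c : {ffun edge G -> 'I_k}, proper_coloring c].

Lemma edge_colorable_card (G : mgraph) : edge_colorable G #|edge G|.
Proof.
apply/existsP; exists [ffun e => enum_rank e].
apply/forallP=> e; apply/forallP=> f; apply/implyP=> /andP[ef _].
by rewrite !ffunE (inj_eq enum_rank_inj).
Qed.

Lemma ex_edge_colorable (G : mgraph) : exists k, edge_colorable G k.
Proof. by exists #|edge G|; apply: edge_colorable_card. Qed.

Definition chromatic_index (G : mgraph) : nat := ex_minn (ex_edge_colorable G).

Definition class1 (G : mgraph) : bool := chromatic_index G == max_degree G.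

Definition del_edges (G : mgraph) (F : {set edge G}) : mgraph :=
  @MGraph (vertex G) {e : edge G | e \notin F}
    (fun e => ends (val e)) (fun e => card_ends (val e)).

Definition del_vertices_ends (G : mgraph) (S : {set vertex G})
    (e : {e : edge G | [disjoint ends e & S]}) :
    {set {x : vertex G | x \notin S}} :=
  [set x | val x \in ends (val e)].

Lemma card_del_vertices_ends (G : mgraph) (S : {set vertex G})
    (e : {e : edge G | [disjoint ends e & S]}) :
  #|del_vertices_ends e| = 2.
Proof.
rewrite -(card_ends (val e)) -(card_imset _ val_inj); congr #|pred_of_set _|.
apply/setP=> x; apply/imsetP/idP=> [[y]|xe]; first by rewrite inE => ye ->.
have xS : x \notin S by rewrite (disjointFr (valP e) xe).
by exists (Sub x xS); rewrite ?inE ?SubK.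
Qed.

Definition del_vertices (G : mgraph) (S : {set vertex G}) : mgraph :=
  @MGraph {x : vertex G | x \notin S} {e : edge G | [disjoint ends e & S]}
    (@del_vertices_ends G S) (@card_del_vertices_ends G S).

Lemma edgeless_colorable (G : mgraph) k : #|edge G| = 0 -> edge_colorable G k.
Proof.
move=> E0; apply/existsP.
have none (e : edge G) : False by have := fintype0 e E0.
exists [ffun e => False_rect _ (none e)].
by apply/forallP=> e; case: (none e).
Qed.

Lemma edgeless_chromatic_index (G : mgraph) :
  #|edge G| = 0 -> chromatic_index G = 0.
Proof.
move=> E0; rewrite /chromatic_index; case: ex_minnP => k _ /(_ 0).
by rewrite edgeless_colorable // leqn0 => /(_ isT) /eqP.
Qed.

Lemma edgeless_class1 (G : mgraph) : #|edge G| = 0 -> class1 G.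
Proof.
move=> E0; rewrite /class1 edgeless_chromatic_index // eq_sym -leqn0.
by apply/bigmax_leqP=> x _; rewrite -E0 max_card.
Qed.

Lemma del_edgesT_edgeless (G : mgraph) :
  #|edge (del_edges [set: edge G])| = 0.
Proof. by apply: eq_card0 => -[e He]; exfalso; rewrite inE in He. Qed.

Lemma del_verticesT_edgeless (G : mgraph) :
  #|edge (del_vertices [set: vertex G])| = 0.
Proof.
apply: eq_card0 => -[e He]; exfalso.
have: 0 < #|ends e| by rewrite card_ends.
by case/card_gt0P=> x xe; have := disjointFr He xe; rewrite inE.
Qed.

Definition resistance_pred (G : mgraph) (n : nat) : bool :=
  [exists F : {set edge G},
     (#|F| == n) && edge_colorable (del_edges F) (max_degree G)].

Definition vresistance_pred (G : mgraph) (n : nat) : bool :=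
  [exists S : {set vertex G}, (#|S| == n) && class1 (del_vertices S)].

Definition vresistance'_pred (G : mgraph) (n : nat) : bool :=
  [exists S : {set vertex G},
     (#|S| == n) && (chromatic_index (del_vertices S) <= max_degree G)].

Lemma ex_resistance (G : mgraph) : exists n, resistance_pred G n.
Proof.
exists #|[set: edge G]|; apply/existsP; exists [set: edge G].
by rewrite eqxx edgeless_colorable // del_edgesT_edgeless.
Qed.

Lemma ex_vresistance (G : mgraph) : exists n, vresistance_pred G n.
Proof.
exists #|[set: vertex G]|; apply/existsP; exists [set: vertex G].
by rewrite eqxx edgeless_class1 // del_verticesT_edgeless.
Qed.

Lemma ex_vresistance' (G : mgraph) : exists n, vresistance'_pred G n.
Proof.
exists #|[set: vertex G]|; apply/existsP; exists [set: vertex G].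
by rewrite eqxx edgeless_chromatic_index // del_verticesT_edgeless.
Qed.

(* The parameters r, r_v and r'_v. *)
Definition resistance (G : mgraph) : nat := ex_minn (ex_resistance G).
Definition vresistance (G : mgraph) : nat := ex_minn (ex_vresistance G).
Definition vresistance' (G : mgraph) : nat := ex_minn (ex_vresistance' G).

Definition qratio (m n : nat) : rat := (m%:R / n%:R)%R.

(* Main.v *)
(** Let [k = Delta(G)] and let [G - S] be [k]-edge-colourable.  Among the
    partial proper [k]-colourings of [G] whose uncoloured edges all meet [S],
    take one whose set of uncoloured edges is minimal.  Let [v] be a vertex and
    let [w], [w'] be further ends of uncoloured edges at [v].  By minimality no
    colour is missing at both [v] and [w].  If a colour [b] were missing at [w]
    and at [w'] <> [w], and [a] at [v], then one of [w], [w'] would not lie on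
    the [a]/[b]-chain of [v], and a Kempe swap there would allow one more edge
    to be coloured.  So the sets of colours missing at the ends [w] are disjoint
    and consist of colours present at [v]; as each [w] misses at least as many
    colours as it has uncoloured edges, at most half of the edges at [v] are
    uncoloured.  Summing over [S] gives [r <= (k / 2) * r'_v <= (k / 2) * r_v].

    The bound is attained by the triangle with edge multiplicities [t], [t] and
    [D - t], where [t = D / 2]: its [D + t] edges pairwise intersect, so [t] of
    them must go, whereas deleting one vertex leaves a bundle of parallel
    edges. *)

Require Import Defs.
From mathcomp Require Import all_boot all_order all_algebra.
From mathcomp Require Import perm zify.

Set Implicit Arguments.
Unset Strict Implicit.
Unset Printing Implicit Defensive.

Lemma leq_card_bigcup (I T : finType) (P : pred I) (F : I -> {set T}) :
  #|\bigcup_(i | P i) F i| <= \sum_(i | P i) #|F i|.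
Proof.
elim/big_rec2: _ => [|i n U _ leUn]; first by rewrite cards0.
by rewrite (leq_trans (leq_card_setU _ _)) // leq_add2l.
Qed.

Lemma leq_sum_card_disjoint (I T : finType) (A : {set I}) (F : I -> {set T})
    (B : {set T}) :
  {in A, forall i, F i \subset B} ->
  {in A &, forall i j, i != j -> [disjoint F i & F j]} ->
  \sum_(i in A) #|F i| <= #|B|.
Proof.
move=> FB Fdisj; under eq_bigr do rewrite -sum1_card.
rewrite pair_big_dep sum1dep_card /= -(card_in_imset (f := snd)).
  apply/subset_leq_card/subsetP=> _ /imsetP[[i x] + ->].
  by rewrite inE => /andP[/FB/subsetP]; apply.
move=> [i x] [j y]; rewrite !inE /= => /andP[iA ix] /andP[jA jy] xy.
rewrite -xy in jy *; congr (_, _); apply/eqP; apply: contraTT jy => ij.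
by rewrite (disjointFr (Fdisj i j iA jA ij) ix).
Qed.

Lemma iter_fixed_gcdn (T : Type) (f : T -> T) (x : T) m n :
  iter m f x = x -> iter n f x = x -> iter (gcdn m n) f x = x.
Proof.
have [-> _|m_gt0 fm fn] := posnP m; first by rewrite gcd0n.
case: (egcdnP n m_gt0) => a b bezout _.
have := iter_fix a fm; rewrite -iterM bezout addnC iterD iterM.
by rewrite (iter_fix b fn).
Qed.

Section TwoInvolutions.

Variables (T : finType) (A B : T -> T).
Hypotheses (AK : involutive A) (BK : involutive B).

Local Notation s := (A \o B).
Local Notation s' := (B \o A).

Let iter_s'K n : cancel (iter n s') (iter n s).
Proof. by elim: n => // n IHn x; rewrite iterSr iterS (can_comp BK AK). Qed.

Let B_iter n x : B (iter n s x) = iter n s' (B x).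
Proof. by elim: n => // n IHn; rewrite !iterS -IHn. Qed.

Let iter_odd_fixed v n :
  A v = v -> B (iter n s v) = iter n s v -> iter n.*2.+1 s v = v.
Proof.
move=> Av; rewrite B_iter -{1}Av -[B (A v)]/(s' v) -iterSr => Bn.
by rewrite -addnn -addSn iterD -Bn iter_s'K.
Qed.

(* If [B] fixes [iter i s v] and [iter j s v] then [i.*2.+1] and [j.*2.+1] are
   periods of [v], hence so is their odd gcd, which divides [j - i]. *)
Lemma involutions_fixed_unique v w1 w2 : A v = v -> B w1 = w1 -> B w2 = w2 ->
  fconnect s v w1 -> fconnect s v w2 -> w1 = w2.
Proof.
move=> Av + + vw1 vw2; rewrite -(iter_findex vw1) -(iter_findex vw2).
move: (findex s v w1) (findex s v w2) => i j {vw1 vw2}.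
wlog le_ij : i j / i <= j => [hwlog Bi Bj|Bi Bj].
  by case/orP: (leq_total i j) => [ij|ji]; [|symmetry]; apply: hwlog.
have period_gcd :=
  iter_fixed_gcdn (iter_odd_fixed Av Bi) (iter_odd_fixed Av Bj).
have /dvdnP[q Dq] : gcdn i.*2.+1 j.*2.+1 %| j - i.
  rewrite -(@Gauss_dvdr _ 2).
    have -> : 2 * (j - i) = j.*2.+1 - i.*2.+1 by lia.
    by rewrite dvdn_sub ?dvdn_gcdl ?dvdn_gcdr.
  rewrite coprimen2; apply: dvdn_odd (dvdn_gcdl _ _) _.
  by rewrite /= odd_double.
by rewrite -(subnKC le_ij) iterD Dq iterM (iter_fix q period_gcd).
Qed.

Lemma fconnect_involutions_sym x y : fconnect s x y = fconnect s y x.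
Proof. exact: fconnect_sym (can_inj (can_comp AK BK)) x y. Qed.

Lemma fconnect_involutions_closed w x : B w = w -> fconnect s w x ->
  fconnect s w (A x) /\ fconnect s w (B x).
Proof.
move=> Bw wx; have wBx : fconnect s w (B x).
  rewrite -(iter_findex wx) B_iter Bw fconnect_involutions_sym.
  by rewrite -[X in fconnect _ _ X](iter_s'K (findex s w x)) fconnect_iter.
split=> //; rewrite -[x]BK.
exact: connect_trans wBx (fconnect1 _ _).
Qed.

End TwoInvolutions.

Section Graphs.

Variable G : mgraph.
Implicit Types (e f : edge G) (x y : vertex G) (k : nat).

Definition edges_at x : {set edge G} := [set e | x \in ends e].

Lemma degree_le_max x : degree x <= max_degree G.
Proof. exact: (leq_bigmax_cond (F := @degree G)). Qed.

Lemma ends_set2 e x y : x \in ends e -> y \in ends e -> x != y ->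
  ends e = [set x; y].
Proof.
move=> xe ye xy; apply/esym/eqP; rewrite eqEcard cards2 xy card_ends leqnn.
by rewrite andbT; apply/subsetP=> z; rewrite !inE => /orP[]/eqP->.
Qed.

Definition opposite e x : vertex G := odflt x [pick y in ends e :\ x].

Lemma opposite_neq e x : opposite e x != x.
Proof.
rewrite /opposite; case: pickP => [y|/eq_card0 none].
  by rewrite !inE => /andP[].
by have := card_ends e; rewrite (cardsD1 x) none; case: (x \in _).
Qed.

Lemma ends_opposite e x : x \in ends e -> ends e = [set x; opposite e x].
Proof.
move=> xe; apply: ends_set2 => //; last by rewrite eq_sym opposite_neq.
have := opposite_neq e x; rewrite /opposite.
by case: pickP => [y|_ /eqP//]; rewrite !inE => /andP[].
Qed.

Lemma opposite_in e x : x \in ends e -> opposite e x \in ends e.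
Proof. by move/ends_opposite->; rewrite set22. Qed.

Lemma oppositeK e x : x \in ends e -> opposite e (opposite e x) = x.
Proof.
move=> xe; have := xe; rewrite (ends_opposite (opposite_in xe)) !inE.
by rewrite eq_sym (negPf (opposite_neq e x)) => /eqP.
Qed.

Lemma proper_coloringP k (c : {ffun edge G -> 'I_k}) :
  reflect (forall e f x, x \in ends e -> x \in ends f -> c e = c f -> e = f)
          (proper_coloring c).
Proof.
apply: (iffP forallP) => [c_proper e f x xe xf cef|c_inj e].
  have /forallP/(_ f) := c_proper e; rewrite cef eqxx implybF negb_and !negbK.
  by case/orP=> [/eqP//|/disjointFr/(_ xe)]; rewrite xf.
apply/forallP=> f; apply/implyP=> /andP[ef /pred0Pn[x /=/andP[xe xf]]].
by apply: contra ef => /eqP cef; apply/eqP/(c_inj e f x).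
Qed.

Lemma edge_colorable_mono j k : j <= k ->
  edge_colorable G j -> edge_colorable G k.
Proof.
move=> jk /existsP[c /proper_coloringP c_inj]; apply/existsP.
exists [ffun e => widen_ord jk (c e)]; apply/proper_coloringP=> e f x xe xf.
rewrite !ffunE => /(congr1 val) cef; apply: (c_inj e f x) => //.
exact: val_inj.
Qed.

Lemma chromatic_index_le k : (chromatic_index G <= k) = edge_colorable G k.
Proof.
rewrite /chromatic_index; case: ex_minnP => j colj minj.
by apply/idP/idP=> [jk|/minj//]; apply: edge_colorable_mono colj.
Qed.

Lemma edge_colorable_intersecting k (E : {set edge G}) :
  {in E &, forall e f, ~~ [disjoint ends e & ends f]} ->
  edge_colorable G k -> #|E| <= k.
Proof.
move=> meet /existsP[c /proper_coloringP c_inj]; rewrite -[k]card_ord.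
rewrite -(card_in_imset (f := c)) ?max_card // => e f eE fE.
by have /pred0Pn[x /=/andP[xe xf]] := meet e f eE fE; apply: c_inj xe xf.
Qed.

Lemma max_degree_chromatic_index : max_degree G <= chromatic_index G.
Proof.
apply/bigmax_leqP=> x _; apply: (@edge_colorable_intersecting _ (edges_at x)).
  by move=> e f; rewrite !inE => xe xf; apply/pred0Pn; exists x; rewrite /= xe.
by rewrite -chromatic_index_le.
Qed.

Lemma common_end_class1 x : (forall e, x \in ends e) -> class1 G.
Proof.
move=> x_all; rewrite /class1 eqn_leq max_degree_chromatic_index andbT.
apply: leq_trans (degree_le_max x).
have -> : degree x = #|edge G|.
  by rewrite -cardsT; apply: eq_card => e; rewrite !inE x_all.
by rewrite chromatic_index_le edge_colorable_card.
Qed.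

Lemma max_degree_del_vertices (S : {set vertex G}) :
  max_degree (del_vertices S) <= max_degree G.
Proof.
apply/bigmax_leqP=> x _; apply: leq_trans (degree_le_max (val x)).
rewrite /degree -(card_imset _ val_inj); apply: subset_leq_card.
by apply/subsetP=> e /imsetP[e']; rewrite !inE => xe ->.
Qed.

Lemma resistance_le (F : {set edge G}) :
  edge_colorable (del_edges F) (max_degree G) -> resistance G <= #|F|.
Proof.
move=> colF; rewrite /resistance; case: ex_minnP => n _; apply.
by apply/existsP; exists F; rewrite eqxx.
Qed.

Lemma vresistance_le (S : {set vertex G}) :
  class1 (del_vertices S) -> vresistance G <= #|S|.
Proof.
move=> S_class1; rewrite /vresistance; case: ex_minnP => n _; apply.
by apply/existsP; exists S; rewrite eqxx.
Qed.

Lemma vresistance'_le_vresistance : vresistance' G <= vresistance G.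
Proof.
rewrite /vresistance; case: ex_minnP => n.
case/existsP=> S /andP[cardS /eqP S_class1] _.
rewrite /vresistance'; case: ex_minnP => m _; apply.
by apply/existsP; exists S; rewrite cardS S_class1 max_degree_del_vertices.
Qed.

End Graphs.

Lemma intersecting_card_edge_le (G : mgraph) :
  (forall e f : edge G, ~~ [disjoint ends e & ends f]) ->
  #|edge G| <= max_degree G + resistance G.
Proof.
move=> meet; rewrite /resistance.
case: ex_minnP => n /existsP[F /andP[/eqP <- colF]] _.
rewrite addnC -(cardsC F) leq_add2l; have -> : #|~: F| = #|edge (del_edges F)|.
  by rewrite card_sig; apply: eq_card => e; rewrite inE.
rewrite -cardsT; apply: edge_colorable_intersecting colF => e f _ _.
exact: meet.
Qed.

Section PartialColorings.

Variables (G : mgraph) (k : nat).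
Implicit Types (c : {ffun edge G -> option 'I_k}) (e f : edge G).
Implicit Types (x y v w : vertex G) (a b : 'I_k) (X : {set vertex G}).

Definition uncolored c : {set edge G} := [set e | c e == None].

Definition uncolored_at c x : {set edge G} := edges_at x :&: uncolored c.

Definition colored_at c x : {set edge G} := edges_at x :\: uncolored c.

Lemma card_uncolored_colored_at c x :
  #|uncolored_at c x| + #|colored_at c x| = degree x.
Proof. exact: cardsID. Qed.

Definition partial_proper c : bool :=
  [forall x, dinjectiveb c (mem (colored_at c x))].

Lemma partial_properP c :
  reflect (forall e f x a, x \in ends e -> x \in ends f ->
             c e = Some a -> c f = Some a -> e = f)
          (partial_proper c).
Proof.
apply: (iffP forallP) => [c_inj e f x a xe xf ce cf|c_inj x].
  by have /dinjectiveP := c_inj x; apply; rewrite ?ce // !inE ?ce ?cf ?xe.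
apply/dinjectiveP=> e f; rewrite !inE => /andP[+ xe] /andP[_ xf] cef.
by case ce: (c e) => [a|//] _; apply: (c_inj e f x a); rewrite // -cef.
Qed.

Definition present c x : {set 'I_k} := [set a | Some a \in c @: edges_at x].

Definition missing c x : {set 'I_k} := ~: present c x.

Lemma presentP c x a :
  reflect (exists2 e, x \in ends e & c e = Some a) (a \in present c x).
Proof.
rewrite inE; apply: (iffP imsetP) => -[e].
  by rewrite inE => xe ca; exists e.
by move=> xe ca; exists e; rewrite ?inE.
Qed.

Lemma missingP c x a :
  reflect (forall e, x \in ends e -> c e <> Some a) (a \in missing c x).
Proof.
rewrite inE; apply: (iffP negP) => [absent e xe ce|absent /presentP[e xe]].
  by apply/absent/presentP; exists e.
exact: absent.
Qed.

Lemma card_present c x : partial_proper c -> #|present c x| = #|colored_at c x|.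
Proof.
move=> /forallP/(_ x)/dinjectiveP c_inj.
rewrite -(card_in_imset c_inj) -(card_imset _ (@Some_inj _)).
apply: eq_card => o; apply/imsetP/imsetP=> [[a /presentP[e xe ce] ->]|[e]].
  by exists e; rewrite // !inE xe ce.
rewrite !inE => /andP[+ xe] ->; case ce: (c e) => [a|//] _.
by exists a => //; apply/presentP; exists e.
Qed.

Lemma card_uncolored_at_missing c x : partial_proper c -> degree x <= k ->
  #|uncolored_at c x| <= #|missing c x|.
Proof.
move=> c_proper; rewrite -(card_uncolored_colored_at c x) -card_present //.
by have := cardsC (present c x); rewrite card_ord -/(missing c x); lia.
Qed.

Definition uncolored_neighbors c v : {set vertex G} :=
  [set opposite e v | e in uncolored_at c v].

Lemma uncolored_neighbors_edge c v w : w \in uncolored_neighbors c v ->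
  exists2 e, ends e = [set v; w] & c e = None.
Proof.
case/imsetP=> e; rewrite !inE => /andP[ve /eqP ce] ->.
by exists e; rewrite // -ends_opposite.
Qed.

Lemma card_uncolored_at_le_sum c v : partial_proper c ->
  (forall x : vertex G, degree x <= k) ->
  #|uncolored_at c v| <= \sum_(w in uncolored_neighbors c v) #|missing c w|.
Proof.
move=> c_proper degree_le.
rewrite -sum1_card (partition_big_imset (fun e => opposite e v)) /=.
apply: leq_sum => w _; rewrite sum1dep_card.
apply: leq_trans (card_uncolored_at_missing c_proper (degree_le w)).
apply/subset_leq_card/subsetP=> e; rewrite !inE => /andP[/andP[ve ce] /eqP <-].
by rewrite opposite_in.
Qed.

Lemma extend_coloring c e v w a : partial_proper c -> ends e = [set v; w] ->
  a \in missing c v -> a \in missing c w ->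
  exists2 c', partial_proper c' & uncolored c' = uncolored c :\ e.
Proof.
move=> /partial_properP c_inj vw /missingP av /missingP aw.
have a_new f x : x \in ends e -> x \in ends f -> c f <> Some a.
  by rewrite vw !inE => /orP[]/eqP->; [apply: av|apply: aw].
exists [ffun f => if f == e then Some a else c f]; last first.
  by apply/setP=> f; rewrite !inE ffunE; case: (f =P e).
apply/partial_properP=> f g x b xf xg; rewrite !ffunE.
case: eqP => [fe|_]; case: eqP => [ge|_].
- by rewrite fe ge.
- by case=> <- cg; case: (a_new g x); rewrite -?fe.
- by move=> cf [ab]; case: (a_new f x); rewrite -?ge // cf ab.
- exact: c_inj xf xg.
Qed.

Definition partner c a x : vertex G :=
  if [pick e in edges_at x | c e == Some a] is Some e then opposite e x else x.

Lemma partner_missing c a x : a \in missing c x -> partner c a x = x.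
Proof.
move/missingP=> ax; rewrite /partner; case: pickP => // e.
by rewrite inE => /andP[/ax ce /eqP].
Qed.

Lemma partner_opposite c a x e : partial_proper c -> x \in ends e ->
  c e = Some a -> partner c a x = opposite e x.
Proof.
move=> /partial_properP c_inj xe ce; rewrite /partner.
case: pickP => [f|/(_ e)]; last by rewrite inE xe ce eqxx.
by rewrite inE => /andP[xf /eqP cf]; rewrite (c_inj e f x a).
Qed.

Lemma partnerK c a : partial_proper c -> involutive (partner c a).
Proof.
move=> c_proper x; have [/presentP[e xe ce]|] := boolP (a \in present c x).
  rewrite (partner_opposite c_proper xe ce).
  by rewrite (partner_opposite c_proper (opposite_in xe) ce) oppositeK.
by rewrite -in_setC => ax; rewrite !partner_missing.
Qed.

Definition partner_closed c a X := forall x, x \in X -> partner c a x \in X.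

Lemma partner_closed_out c a X x e : partial_proper c -> partner_closed c a X ->
  x \in ends e -> x \notin X -> ~~ [disjoint ends e & X] -> c e != Some a.
Proof.
move=> c_proper clX xe xX /pred0Pn[y /=/andP[ye yX]].
apply: contra xX => /eqP ce; move: ye; rewrite (ends_opposite xe) !inE.
case/orP=> /eqP y_x; rewrite y_x // in yX.
by rewrite -(partnerK a c_proper x) (partner_opposite c_proper xe ce) clX.
Qed.

Definition kempe_swap c a b X : {ffun edge G -> option 'I_k} :=
  [ffun e => if [disjoint ends e & X] then c e else omap (tperm a b) (c e)].

Lemma uncolored_kempe_swap c a b X :
  uncolored (kempe_swap c a b X) = uncolored c.
Proof. by apply/setP=> e; rewrite !inE ffunE; case: ifP; case: (c e). Qed.

Lemma kempe_swap_in c a b X x e : x \in X -> x \in ends e ->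
  kempe_swap c a b X e = omap (tperm a b) (c e).
Proof.
by move=> xX xe; rewrite ffunE ifN //; apply/pred0Pn; exists x; rewrite /= xe.
Qed.

Section KempeSwap.

Variables (c : {ffun edge G -> option 'I_k}) (a b : 'I_k) (X : {set vertex G}).
Hypotheses (c_proper : partial_proper c) (clXa : partner_closed c a X).
Hypothesis clXb : partner_closed c b X.

Lemma kempe_swap_out x e : x \notin X -> x \in ends e ->
  kempe_swap c a b X e = c e.
Proof.
move=> xX xe; rewrite ffunE; case: ifPn => // eX.
have := partner_closed_out c_proper clXa xe xX eX.
have := partner_closed_out c_proper clXb xe xX eX.
by case: (c e) => //= g gb ga; rewrite tpermD // eq_sym.
Qed.

Lemma kempe_swap_proper : partial_proper (kempe_swap c a b X).
Proof.
apply/partial_properP=> e f x g xe xf; have /partial_properP c_inj := c_proper.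
have [xX|xX] := boolP (x \in X).
  rewrite !(kempe_swap_in _ _ _ xX) //.
  case ce: (c e) => [h|//] /= [<-].
  case cf: (c f) => [h'|//] /= [/perm_inj h'_h].
  by apply: (c_inj e f x h); rewrite // cf h'_h.
by rewrite !(kempe_swap_out xX) //; apply: c_inj xe xf.
Qed.

Lemma missing_kempe_swap_out x : x \notin X ->
  missing (kempe_swap c a b X) x = missing c x.
Proof.
move=> xX; congr (~: _); apply/setP=> g.
apply/presentP/presentP=> -[e xe ce]; exists e => //; move: ce;
  by rewrite (kempe_swap_out xX).
Qed.

End KempeSwap.

Lemma missing_kempe_swap_in c a b X x g : x \in X ->
  (g \in missing (kempe_swap c a b X) x) = (tperm a b g \in missing c x).
Proof.
move=> xX; rewrite !in_setC; congr (~~ _).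
apply/presentP/presentP=> -[e xe ce]; exists e => //; move: ce.
  rewrite (kempe_swap_in _ _ _ xX) //.
  by case: (c e) => //= h [<-]; rewrite tpermK.
by rewrite (kempe_swap_in _ _ _ xX) // => -> /=; rewrite tpermK.
Qed.

(* This is the whole [a]/[b]-chain of [w] when [b] is missing at [w]; otherwise
   it may be only every other vertex of it. *)
Definition kempe_chain c a b w : {set vertex G} :=
  [set x | fconnect (partner c a \o partner c b) w x].

Lemma kempe_chain_closed c a b w : partial_proper c -> b \in missing c w ->
  partner_closed c a (kempe_chain c a b w) /\
  partner_closed c b (kempe_chain c a b w).
Proof.
move=> c_proper /partner_missing bw.
split=> x; rewrite !inE => wx;
  by have [] := fconnect_involutions_closed (partnerK a c_proper)
                  (partnerK b c_proper) bw wx.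
Qed.

Lemma kempe_chain_end_unique c a b v w1 w2 : partial_proper c ->
  a \in missing c v -> b \in missing c w1 -> b \in missing c w2 ->
  v \in kempe_chain c a b w1 -> v \in kempe_chain c a b w2 -> w1 = w2.
Proof.
move=> c_proper av bw1 bw2; have aK := partnerK a c_proper.
have bK := partnerK b c_proper.
rewrite !inE !(fconnect_involutions_sym aK bK _ v).
by apply: involutions_fixed_unique; rewrite ?partner_missing.
Qed.

Definition maximal_coloring c :=
  partial_proper c /\
  forall c', partial_proper c' -> ~~ (uncolored c' \proper uncolored c).

Lemma ex_maximal_coloring c0 : partial_proper c0 ->
  exists2 c, maximal_coloring c & uncolored c \subset uncolored c0.
Proof.
move=> c0_proper.
pose P c := partial_proper c && (uncolored c \subset uncolored c0).
have Pc0 : P c0 by rewrite /P c0_proper subxx.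
case: (@arg_minnP _ c0 P (fun c => #|uncolored c|) Pc0) => c.
case/andP=> c_proper sub_c c_min; exists c => //; split=> // c' c'_proper.
apply/negP=> c'c; have := proper_card c'c; rewrite ltnNge c_min // /P c'_proper.
exact: subset_trans (proper_sub c'c) sub_c.
Qed.

Section MaximalColoring.

Variables (c : {ffun edge G -> option 'I_k}) (v : vertex G).
Hypothesis c_max : maximal_coloring c.
Hypothesis degree_le : forall x : vertex G, degree x <= k.

Let c_proper : partial_proper c := proj1 c_max.

Lemma maximal_coloring_unextendable c' e : partial_proper c' -> c e = None ->
  uncolored c' <> uncolored c :\ e.
Proof.
move=> /(proj2 c_max) + ce c'U; rewrite c'U properD1 //.
by rewrite inE ce.
Qed.

Lemma maximal_missing_subset e w : ends e = [set v; w] -> c e = None ->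
  missing c w \subset present c v.
Proof.
move=> vw ce; apply/subsetP=> b bw; apply: contraT; rewrite -in_setC => bv.
have [c' c'_proper] := extend_coloring c_proper vw bv bw.
by move/(maximal_coloring_unextendable c'_proper ce).
Qed.

(* Otherwise swapping the two colours along the chain of [w] frees a colour
   common to both ends of [e]. *)
Lemma maximal_kempe_chain e w a b : ends e = [set v; w] -> c e = None ->
  a \in missing c v -> b \in missing c w -> v \in kempe_chain c a b w.
Proof.
move=> vw ce av bw; apply: contraT => v_out.
have [clXa clXb] := kempe_chain_closed a c_proper bw.
have w_in : w \in kempe_chain c a b w by rewrite inE connect0.
have swap_proper := kempe_swap_proper c_proper clXa clXb.
have [||c' c'_proper] := extend_coloring (a := a) swap_proper vw.
- by rewrite missing_kempe_swap_out.
- by rewrite missing_kempe_swap_in // tpermL.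
rewrite uncolored_kempe_swap.
by move/(maximal_coloring_unextendable c'_proper ce).
Qed.

Lemma maximal_missing_disjoint a : a \in missing c v ->
  {in uncolored_neighbors c v &, forall w1 w2, w1 != w2 ->
     [disjoint missing c w1 & missing c w2]}.
Proof.
move=> av w1 w2 /uncolored_neighbors_edge[e1 vw1 ce1].
case/uncolored_neighbors_edge=> e2 vw2 ce2.
apply: contraR => /pred0Pn[b /=/andP[bw1 bw2]]; apply/eqP.
apply: (kempe_chain_end_unique c_proper av bw1 bw2).
  exact: maximal_kempe_chain vw1 ce1 av bw1.
exact: maximal_kempe_chain vw2 ce2 av bw2.
Qed.

Lemma maximal_card_uncolored_at : #|uncolored_at c v| <= k %/ 2.
Proof.
suff le_present : #|uncolored_at c v| <= #|present c v|.
  have := degree_le v; rewrite -(card_uncolored_colored_at c v).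
  by rewrite -card_present //; lia.
have [->|[e eU]] := set_0Vmem (uncolored_at c v); first by rewrite cards0.
have /card_gt0P[a av] : 0 < #|missing c v|.
  apply: leq_trans (card_uncolored_at_missing c_proper (degree_le v)).
  by apply/card_gt0P; exists e.
apply: leq_trans (card_uncolored_at_le_sum v c_proper degree_le) _.
apply: leq_sum_card_disjoint (maximal_missing_disjoint av).
move=> w /uncolored_neighbors_edge[f vw cf].
exact: maximal_missing_subset vw cf.
Qed.

End MaximalColoring.

Lemma del_uncolored_colorable c : partial_proper c ->
  edge_colorable (del_edges (uncolored c)) k.
Proof.
move/partial_properP=> c_inj.
have colored (e : edge (del_edges (uncolored c))) :
    exists a, c (val e) == Some a.
  by have := valP e; rewrite /= inE; case: (c _) => [a|//] _; exists a.
apply/existsP; exists [ffun e => xchoose (colored e)].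
apply/proper_coloringP=> e f x xe xf; rewrite !ffunE => cef; apply: val_inj.
apply: (c_inj _ _ x (xchoose (colored e)) xe xf).
  exact/eqP/(xchooseP (colored e)).
by rewrite cef; apply/eqP/(xchooseP (colored f)).
Qed.

Lemma del_vertices_partial_coloring (S : {set vertex G}) :
  edge_colorable (del_vertices S) k ->
  exists2 c, partial_proper c
    & forall e, e \in uncolored c -> ~~ [disjoint ends e & S].
Proof.
case/existsP=> d /proper_coloringP d_inj.
exists [ffun e => omap d (insub e)]; last first.
  by move=> e; rewrite inE ffunE; case: insubP.
apply/partial_properP=> e f x a xe xf; rewrite !ffunE.
case: insubP => [e' eS ee'|//] /= [de]; case: insubP => [f' fS ff'|//] /= [df].
have xS : x \notin S by rewrite (disjointFr eS xe).
rewrite -ee' -ff'; congr val; apply: (d_inj e' f' (Sub x xS)).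
- by rewrite inE SubK ee'.
- by rewrite inE SubK ff'.
- by rewrite de.
Qed.

Lemma del_vertices_del_edges_colorable (S : {set vertex G}) :
  (forall x : vertex G, degree x <= k) -> edge_colorable (del_vertices S) k ->
  exists2 F : {set edge G},
    #|F| <= (k %/ 2) * #|S| & edge_colorable (del_edges F) k.
Proof.
move=> degree_le /del_vertices_partial_coloring[c0 c0_proper c0_meets].
have [c c_max /subsetP sub_c] := ex_maximal_coloring c0_proper.
exists (uncolored c); last exact: del_uncolored_colorable (proj1 c_max).
apply: (@leq_trans #|\bigcup_(x in S) uncolored_at c x|).
  apply/subset_leq_card/subsetP=> e eU.
  have /pred0Pn[x /=/andP[xe xS]] := c0_meets e (sub_c e eU).
  by apply/bigcupP; exists x; rewrite // !inE xe; rewrite inE in eU.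
apply: leq_trans (leq_card_bigcup _ _) _.
rewrite mulnC -sum_nat_const; apply: leq_sum => x _.
exact: maximal_card_uncolored_at.
Qed.

End PartialColorings.

Lemma resistance_le_vresistance' (G : mgraph) :
  resistance G <= (max_degree G %/ 2) * vresistance' G.
Proof.
rewrite /vresistance'; case: ex_minnP => n /existsP[S /andP[/eqP <-]] + _.
rewrite chromatic_index_le => colS.
have [F leF colF] := del_vertices_del_edges_colorable (@degree_le_max G) colS.
exact: leq_trans (resistance_le colF) leF.
Qed.

Lemma resistance_le_vresistance (G : mgraph) :
  resistance G <= (max_degree G %/ 2) * vresistance G.
Proof.
apply: leq_trans (resistance_le_vresistance' G) _.
by rewrite leq_mul2l vresistance'_le_vresistance orbT.
Qed.

Lemma qratio_le m n d : 0 < n -> m <= d * n -> (qratio m n <= d%:R)%R.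
Proof.
move=> n_gt0 mdn; rewrite /qratio Num.Theory.ler_pdivrMr ?Num.Theory.ltr0n //.
by rewrite -GRing.Theory.natrM Num.Theory.ler_nat.
Qed.

Section FatTriangle.

Variable m : 'I_3 -> nat.

(* The edges tagged [x] are the [m x] parallel edges of the side opposite to the
   vertex [x]. *)
Definition fat_triangle_ends (e : {x : 'I_3 & 'I_(m x)}) : {set 'I_3} :=
  [set~ tag e].

Lemma card_fat_triangle_ends e : #|fat_triangle_ends e| = 2.
Proof. by rewrite cardsC1 card_ord. Qed.

Definition fat_triangle : mgraph := MGraph card_fat_triangle_ends.

Lemma fat_triangle_ends_meet (e f : edge fat_triangle) :
  ~~ [disjoint ends e & ends f].
Proof.
have le3 : #|ends e :|: ends f| <= 3 by rewrite -[3]card_ord max_card.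
rewrite -setI_eq0 -cards_eq0 -lt0n.
by have := cardsUI (ends e) (ends f); rewrite !card_ends; lia.
Qed.

Lemma card_edge_fat_triangle : #|edge fat_triangle| = \sum_x m x.
Proof.
under [RHS]eq_bigr do rewrite -[m _]card_ord -sum1_card.
by rewrite sig_big_dep /= sum1_card.
Qed.

Lemma degree_fat_triangle (x : vertex fat_triangle) :
  degree x + m x = \sum_y m y.
Proof.
rewrite [RHS](bigD1 x) //= addnC; congr addn.
under [RHS]eq_bigr do rewrite -[m _]card_ord -sum1_card.
rewrite sig_big_dep /= sum1dep_card; apply: eq_card => e.
by rewrite !inE eq_sym andbT.
Qed.

Lemma max_degree_fat_triangle x : (forall y, m x <= m y) ->
  max_degree fat_triangle + m x = \sum_y m y.
Proof.
move=> min_x; rewrite -(degree_fat_triangle x); congr addn.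
apply/anti_leq; rewrite (@degree_le_max fat_triangle x) andbT.
apply/bigmax_leqP=> y _; have := min_x y.
by have := degree_fat_triangle x; have := degree_fat_triangle y; lia.
Qed.

Lemma fat_triangle_connected : (forall x, 0 < m x) -> connected fat_triangle.
Proof.
move=> m_gt0; split=> [|x y]; first by rewrite card_ord.
have [->|xy] := eqVneq x y; first exact: connect0.
have /card_gt0P[z] : 0 < #|~: [set x; y]|.
  by have := cardsC [set x; y]; rewrite cards2 xy card_ord; lia.
rewrite !inE negb_or => /andP[zx zy].
apply/connect1/existsP; exists (Tagged (fun x => 'I_(m x)) (Ordinal (m_gt0 z))).
by apply/eqP/ends_set2; rewrite // !inE eq_sym.
Qed.

Lemma resistance_fat_triangle_ge x : (forall y, m x <= m y) ->
  m x <= resistance fat_triangle.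
Proof.
move=> /max_degree_fat_triangle.
have := intersecting_card_edge_le fat_triangle_ends_meet.
by rewrite card_edge_fat_triangle; lia.
Qed.

Lemma vresistance_fat_triangle_le1 : vresistance fat_triangle <= 1.
Proof.
rewrite -(cards1 (ord0 : vertex fat_triangle)).
apply: vresistance_le; set G' := del_vertices _.
have max_kept : ord_max \notin [set ord0 : vertex fat_triangle] by rewrite inE.
apply: (@common_end_class1 G' (Sub ord_max max_kept)) => -[e e_kept].
rewrite inE /= inE; move: e_kept.
by rewrite /= disjoint_sym disjoints1 !inE negbK => /eqP <-.
Qed.

End FatTriangle.

Theorem theorem3p2 :
  (forall G : mgraph, connected G ->
     [/\ resistance G <= (max_degree G %/ 2) * vresistance G,
         resistance G <= (max_degree G %/ 2) * vresistance' G,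
         0 < vresistance G ->
           (qratio (resistance G) (vresistance G)
              <= (max_degree G %/ 2)%:R)%R
       & 0 < vresistance' G ->
           (qratio (resistance G) (vresistance' G)
              <= (max_degree G %/ 2)%:R)%R])
  /\
  (forall D : nat, 2 <= D ->
     exists G : mgraph,
       [/\ connected G, max_degree G = D,
           0 < vresistance G /\ 0 < vresistance' G,
           (qratio (resistance G) (vresistance G) = (D %/ 2)%:R)%R
         & (qratio (resistance G) (vresistance' G) = (D %/ 2)%:R)%R]).
Proof.
split=> [G _|D D_ge2].
  have r_le_v := resistance_le_vresistance G.
  have r_le_v' := resistance_le_vresistance' G.
  by split=> // v_gt0; apply: qratio_le.
pose m (x : 'I_3) := if x == ord_max then D - D %/ 2 else D %/ 2.
have m_min y : m ord0 <= m y by rewrite /m /=; case: ifP => _; lia.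
pose G := fat_triangle m.
have G_max : max_degree G = D.
  have := max_degree_fat_triangle m_min; rewrite !big_ord_recl big_ord0 /m /=.
  by rewrite -/m -/G; lia.
have r_ge : D %/ 2 <= resistance G := resistance_fat_triangle_ge m_min.
have := resistance_le_vresistance' G; rewrite G_max => r_le.
have v_le1 : vresistance G <= 1 := vresistance_fat_triangle_le1 m.
have v'_le_v := vresistance'_le_vresistance G.
have v'E : vresistance' G = 1 by nia.
have vE : vresistance G = 1 by lia.
have rE : resistance G = D %/ 2 by rewrite v'E in r_le; lia.
exists G; rewrite vE v'E rE /qratio GRing.Theory.divr1; split=> //.
apply: fat_triangle_connected => x; apply: leq_trans (m_min x).
by rewrite /m /=; lia.
Qed.
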